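(* Let $t\ge1$ be an integer. Suppose $\mathbf{x}\in\mathcal{N}_{R,t}$, and set $\gamma_t:=\gamma_{R,t}$ and $\Phi:=2-\|\mathbf{x}-\bar{\mathbf{x}}\|_{F,\infty}^2$; or suppose $\mathbf{x}\in\mathcal{N}_{l,t}$, and set $\gamma_t:=\gamma_{l,t}$ and $\Phi:=2-\|\mathbf{x}-\bar{\mathbf{x}}\|_F^2$. In either case $\Phi>1$, $$\langle\mathbf{x}-\bar{\mathbf{x}},\mathrm{grad}\,\varphi^t(\mathbf{x})\rangle\ge\frac{\Phi}{2L_t}\|\mathrm{grad}\,\varphi^t(\mathbf{x})\|_F^2,$$ and, for every $\nu\in[0,1]$, $$\langle\mathbf{x}-\bar{\mathbf{x}},\mathrm{grad}\,\varphi^t(\mathbf{x})\rangle\ge\nu\cdot\frac{\Phi}{2L_t}\|\mathrm{grad}\,\varphi^t(\mathbf{x})\|_F^2+(1-\nu)\gamma_t\|\mathbf{x}-\bar{\mathbf{x}}\|_F^2.$$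
   Context: Let $1\le r\le d$ and $N\ge2$ be integers and $\mathrm{St}(d,r)=\{x\in\mathbb{R}^{d\times r}:x^\top x=I_r\}$. Inner products are $\langle x,y\rangle=\mathrm{Tr}(x^\top y)$ and $\|\cdot\|_F$ is the Frobenius norm, applied also to stacked tuples $\mathbf{x}=(x_1,\dots,x_N)$. $W\in\mathbb{R}^{N\times N}$ is the communication matrix of a connected undirected graph on $N$ nodes; it is symmetric and doubly stochastic, $W_{ij}\ge0$, $0<W_{ii}<1$, its eigenvalues lie in $(-1,1]$, and its second largest singular value lies in $[0,1)$. $W^t_{ij}$ is the $(i,j)$ entry of $W^t$. $\lambda_2(W^t)$ and $\lambda_N(W^t)$ are the second largest and the smallest eigenvalue of $W^t$; $\mu_t:=1-\lambda_2(W^t)$ and $L_t:=1-\lambda_N(W^t)$. $\varphi^t(\mathbf{x})=\frac14\sum_{i,j=1}^N W^t_{ij}\|x_i-x_j\|_F^2$. The Euclidean gradient has blocks $\nabla\varphi^t_i(\mathbf{x})=x_i-\sum_{j}W^t_{ij}x_j$, and the Riemannian gradient on $\mathrm{St}(d,r)^N$ has blocks $\mathrm{grad}\,\varphi^t_i(\mathbf{x})=\mathcal{P}_{T_{x_i}}(\nabla\varphi^t_i(\mathbf{x}))$ with $\mathcal{P}_{T_x}(y)=y-\frac12x(x^\top y+y^\top x)$. For $\mathbf{x}\in\mathrm{St}(d,r)^N$, the induced arithmetic mean (IAM) $\bar x$ is a minimizer of $\sum_i\|y-x_i\|_F^2$ over $y\in\mathrm{St}(d,r)$; $\bar{\mathbf{x}}=(\bar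 x,\dots,\bar x)$; $\|\mathbf{x}-\bar{\mathbf{x}}\|_{F,\infty}=\max_{i}\|x_i-\bar x\|_F$. Regions: $\mathcal{N}_{R,t}=\{\mathbf{x}\in \mathrm{St}(d,r)^N:\|\mathbf{x}-\bar{\mathbf{x}}\|_F^2\le N\delta_{1,t}^2,\ \|\mathbf{x}-\bar{\mathbf{x}}\|_{F,\infty}\le\delta_{2,t}\}$, where the positive constants satisfy $\delta_{1,t}\le\frac{1}{5\sqrt r}\delta_{2,t}$ and $\delta_{2,t}\le\frac16$. $\mathcal{N}_{l,t}=\{\mathbf{x}\in \mathrm{St}(d,r)^N:\varphi^t(\mathbf{x})\le\frac{\mu_t}{4},\ \|\mathbf{x}-\bar{\mathbf{x}}\|_F^2\le N\delta_{3,t}^2\}$, where the positive constant satisfies $\delta_{3,t}\le\min\{\frac1{\sqrt N},\frac1{4\sqrt r}\}$. Constants: $\gamma_{R,t}=(1-4r\delta_{1,t}^2)(1-\frac{\delta_{2,t}^2}{2})\mu_t$ and $\gamma_{l,t}=\mu_t(1-4r\delta_{3,t}^2)-\varphi^t(\mathbf{x})$. *)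

(* Defs.v *)
From HB Require Import structures.
From mathcomp Require Import all_boot all_order all_algebra.
From mathcomp Require Import boolp classical_sets reals.
Set Implicit Arguments.
Unset Strict Implicit.
Unset Printing Implicit Defensive.
Import Order.TTheory GRing.Theory Num.Theory.
Local Open Scope classical_set_scope.
Local Open Scope ring_scope.

Section Frobenius.
Context {R : realType} {m n : nat}.
Implicit Types A B : 'M[R]_(m, n).

(* The library norm `|A| on matrices is the sup norm, hence these two. *)
Definition finner A B : R := \tr (A^T *m B).
Definition fnorm A : R := Num.sqrt (finner A A).

End Frobenius.

Section StackedFrobenius.
Context {R : realType} {N m n : nat}.
Implicit Types x y : 'I_N -> 'M[R]_(m, n).

Definition stack_inner x y : R := \sum_i finner (x i) (y i).
Definition stack_norm x : R := Num.sqrt (stack_inner x x).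
(* Starting the maximum at 0 is harmless, as norms are nonnegative. *)
Definition stack_norm_inf x : R := \big[Num.max/0]_i fnorm (x i).

End StackedFrobenius.

Section Spectrum.
Context {R : realType} {n : nat}.
Implicit Type A : 'M[R]_n.

(* Eigenvalues in nonincreasing order, repeated according to multiplicity.
   The sequence is unique when it exists, i.e. when the characteristic
   polynomial splits over R (in particular if A is symmetric); otherwise it
   is set to [::]. *)
Definition eigenvalues A : seq R :=
  xget [::] [set s | sorted >=%R s
                     /\ char_poly A = \prod_(a <- s) ('X - a%:P)].

(* 1-based: lambda 1 A is the largest eigenvalue, lambda n A the smallest. *)
Definition lambda (k : nat) A : R := (eigenvalues A)`_k.-1.

(* k-th largest singular value, 1-based. *)
Definition sigma (k : nat) A : R := Num.sqrt (lambda k (A^T *m A)).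

End Spectrum.

Record connected_graph (N : nat) (e : rel 'I_N) : Prop := {
  graph_sym : symmetric e;
  graph_irrefl : irreflexive e;
  graph_connected : forall i j, connect e i j }.

(* W respects the graph e: distinct nodes that are not adjacent do not
   communicate. Positivity of W on the edges is not required. *)
Record communication_matrix (R : realType) (N : nat) (e : rel 'I_N)
    (W : 'M[R]_N) : Prop := {
  comm_supp : forall i j, i != j -> ~~ e i j -> W i j = 0;
  comm_sym : W^T = W;
  comm_ge0 : forall i j, 0 <= W i j;
  comm_row : forall i, \sum_j W i j = 1;
  comm_col : forall j, \sum_i W i j = 1;
  comm_diag : forall i, 0 < W i i < 1;
  comm_eig : forall a, eigenvalue W a -> -1 < a <= 1;
  comm_sigma2 : 0 <= sigma 2 W < 1 }.

Section Consensus.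
Context {R : realType} {N d r : nat}.
Implicit Types (W : 'M[R]_N) (t : nat).
Implicit Types (x : 'I_N -> 'M[R]_(d, r)) (y z xbar : 'M[R]_(d, r)).

Definition stiefel y : Prop := y^T *m y = 1%:M.

Definition mu W t : R := 1 - lambda 2 (W ^+ t).
Definition Lip W t : R := 1 - lambda N (W ^+ t).

Definition phi W t x : R :=
  4^-1 * \sum_i \sum_j (W ^+ t) i j * fnorm (x i - x j) ^+ 2.

Definition egrad_phi W t x : 'I_N -> 'M[R]_(d, r) :=
  fun i => x i - \sum_j (W ^+ t) i j *: x j.

Definition tangent_proj y z : 'M[R]_(d, r) :=
  z - 2^-1 *: (y *m (y^T *m z + z^T *m y)).

Definition rgrad_phi W t x : 'I_N -> 'M[R]_(d, r) :=
  fun i => tangent_proj (x i) (egrad_phi W t x i).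

(* xbar is an induced arithmetic mean of x; it need not be unique. *)
Definition is_IAM x xbar : Prop :=
  stiefel xbar /\
  forall y, stiefel y ->
    \sum_i fnorm (xbar - x i) ^+ 2 <= \sum_i fnorm (y - x i) ^+ 2.

Definition dev x xbar : 'I_N -> 'M[R]_(d, r) := fun i => x i - xbar.

Definition admissible_R (delta1 delta2 : R) : Prop :=
  [/\ 0 < delta1, 0 < delta2,
      delta1 <= (5 * Num.sqrt r%:R)^-1 * delta2 & delta2 <= 6^-1].

Definition admissible_l (delta3 : R) : Prop :=
  0 < delta3 /\
  delta3 <= Num.min (Num.sqrt N%:R)^-1 (4 * Num.sqrt r%:R)^-1.

Definition region_R (delta1 delta2 : R) x xbar : Prop :=
  [/\ forall i, stiefel (x i),
      stack_norm (dev x xbar) ^+ 2 <= N%:R * delta1 ^+ 2 &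
      stack_norm_inf (dev x xbar) <= delta2].

Definition region_l W t (delta3 : R) x xbar : Prop :=
  [/\ forall i, stiefel (x i),
      phi W t x <= mu W t / 4 &
      stack_norm (dev x xbar) ^+ 2 <= N%:R * delta3 ^+ 2].

Definition gamma_R W t (delta1 delta2 : R) : R :=
  (1 - 4 * r%:R * delta1 ^+ 2) * (1 - delta2 ^+ 2 / 2) * mu W t.

Definition gamma_l W t (delta3 : R) x : R :=
  mu W t * (1 - 4 * r%:R * delta3 ^+ 2) - phi W t x.

End Consensus.

(* Main.v *)
(** Write V = W^t, D_i = (x_i - xbar)^T (x_i - xbar) and
    P_i = \sum_j V_ij (x_i - x_j)^T (x_i - x_j). On the Stiefel manifold
    rgrad_i = egrad_i - (1/2) x_i P_i, whence
      <x - xbar, rgrad phi> = 2 phi - (1/4) \sum_i tr (D_i P_i) >= Phi * phi,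
    since tr (D_i P_i) <= tr D_i tr P_i. The first bound follows from
    |rgrad|^2 <= |egrad|^2 <= 2 L phi.
    For the second one, 2 phi >= mu |x - xhat|^2, where xhat is the Euclidean
    mean. Optimality of xbar gives xhat = xbar H with H symmetric; then
    1 - H = (1/2N) \sum_i D_i, so that N |xbar - xhat|^2 <= |x - xbar|^4 / (4N)
    and |x - xhat| is comparable with |x - xbar|.
    In the region N_l, [1 < Phi] does not follow from N delta3^2 <= 1 alone:
    phi <= mu / 4 with mu > 0 gives |x - xhat|^2 <= 1/2, hence |x - xbar|^2 < 1. *)
Require Import Defs.
From HB Require Import structures.
From mathcomp Require Import all_boot all_order all_algebra.
From mathcomp Require Import boolp classical_sets reals.
From mathcomp Require Import complex ring lra.
Set Implicit Arguments.
Unset Strict Implicit.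
Unset Printing Implicit Defensive.
Import Order.TTheory GRing.Theory Num.Theory.
Local Open Scope ring_scope.

(** * Unitary diagonalization of real symmetric matrices *)

Section SpectralTheorem.
Context {R : rcfType} {n : nat}.
Local Notation toC := (real_complex R).
Implicit Types (A : 'M[R]_n) (P : 'M[R[i]]_n) (a : 'I_n -> R).
Local Open Scope sesquilinear_scope.

(** The eigenbasis is complex although [A] is real, because the spectral theorem is applied to the
    hermitian matrix [map_mx toC A]. The eigenvalues [a] are real, and the sums below only involve
    squared moduli of coordinates. *)
Definition diagonalizes P a A : Prop :=
  P \is unitarymx /\
  map_mx toC A = P ^t* *m diag_mx (\row_i toC (a i)) *m P.

Lemma symmetric_diagonalizes A : A^T = A -> exists P a, diagonalizes P a A.
Proof.
move=> Asym; set B := map_mx toC A.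
have Bherm : B \is hermsymmx.
  apply: realsym_hermsym.
    by apply/is_hermitianmxP; rewrite expr0 scale1r map_mx_id // /B map_trmx Asym.
  by apply/mxOverP=> i j; rewrite mxE complex_real.
have Preal := hermitian_spectral_diag_real Bherm.
have Pu := spectral_unitarymx B.
exists (spectralmx B), (fun i => complex.Re (spectral_diag B 0 i)); split=> //.
have /orthomx_spectralP Beq := hermitian_normalmx Bherm.
have -> : \row_i toC (complex.Re (spectral_diag B 0 i)) = spectral_diag B.
  by apply/rowP => i; rewrite mxE RRe_real //; apply: (mxOverP Preal).
by rewrite -(invmx_unitary Pu).
Qed.

Lemma diagonalizesX P a A k : diagonalizes P a A ->
  diagonalizes P (fun i => a i ^+ k) (A ^+ k).
Proof.
case=> Pu EA; split; first exact: Pu.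
have PP : P ^t* *m P = 1%:M.
  by rewrite -invmx_unitary // mulVmx // unitarymx_unit.
elim: k => [|k IHk].
  rewrite expr0 map_mx1.
  have -> : diag_mx (\row_i toC (a i ^+ 0)) = 1%:M.
    by apply/matrixP=> i j; rewrite !mxE expr0.
  by rewrite mulmx1.
rewrite exprS map_mxM IHk EA -!mulmxA (mulmxA P) (unitarymxP Pu) mul1mx.
congr (_ *m _); rewrite !mulmxA; congr (_ *m _).
rewrite mulmx_diag; congr diag_mx; apply/rowP => i.
by rewrite !mxE exprS rmorphM.
Qed.

(** Similar matrices have the same characteristic polynomial; the identity over [R[i]] descends to
    [R] because mapping polynomials by [toC] is injective. *)
Lemma diagonalizes_char_poly P a A : diagonalizes P a A ->
  char_poly A = \prod_(b <- [seq a i | i <- enum 'I_n]) ('X - b%:P).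
Proof.
case=> Pu EA; have PP : P ^t* *m P = 1%:M.
  by rewrite -invmx_unitary // mulVmx // unitarymx_unit.
apply: (map_poly_inj toC); rewrite map_char_poly EA.
rewrite rmorph_prod big_map big_enum /=.
under eq_bigr do rewrite rmorphB /= map_polyX map_polyC /=.
set D := diag_mx _.
have -> : char_poly (P ^t* *m D *m P) = char_poly D.
  rewrite /char_poly /char_poly_mx.
  have -> : 'X%:M - map_mx polyC (P ^t* *m D *m P) =
     map_mx polyC (P ^t*) *m ('X%:M - map_mx polyC D) *m map_mx polyC P.
    rewrite mulmxBr mulmxBl scalar_mxC -(mulmxA 'X%:M) -!map_mxM PP map_mx1.
    by rewrite mulmx1.
  rewrite !det_mulmx mulrAC -det_mulmx -map_mxM PP map_mx1 det1 mul1r.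
  by [].
rewrite char_poly_trig; last exact: diag_mx_is_trig.
by apply: eq_bigr => i _; rewrite !mxE eqxx mulr1n.
Qed.

(* Coordinates in the orthonormal eigenbasis given by the conjugate rows of P. *)
Definition coord P (u : 'cV[R]_n) i : R[i] := (P *m map_mx toC u) i 0.

Definition weight P (u : 'cV[R]_n) i : R := Normc.normc (coord P u i) ^+ 2.

Lemma weight_ge0 P u i : 0 <= weight P u i.
Proof. by rewrite /weight sqr_ge0. Qed.

Lemma weightE P u i : (weight P u i)%:C%C = coord P u i * (coord P u i)^*.
Proof. by rewrite rmorphXn; exact: normCK. Qed.

Lemma coord_dot P u v : P \is unitarymx ->
  toC ((u^T *m v) 0 0) = \sum_i (coord P u i)^* * coord P v i.
Proof.
move=> Pu; have PP : P ^t* *m P = 1%:M.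
  by rewrite -invmx_unitary // mulVmx // unitarymx_unit.
transitivity (((P *m map_mx toC u) ^t* *m (P *m map_mx toC v)) 0 0).
  rewrite trmx_mul map_mxM mulmxA -(mulmxA _ (P ^t*)) PP mulmx1.
  have -> : (map_mx toC u) ^t* = map_mx toC u^T.
    by apply/matrixP=> i j; rewrite !mxE conj_Creal // complex_real.
  by rewrite -map_mxM [RHS]mxE.
by rewrite mxE; apply: eq_bigr => i _; rewrite /coord 2!mxE.
Qed.

Lemma coord_mul P a A u i : diagonalizes P a A ->
  coord P (A *m u) i = toC (a i) * coord P u i.
Proof.
case=> Pu EA; rewrite /coord map_mxM EA -!mulmxA (mulmxA P) (unitarymxP Pu).
by rewrite mul1mx mul_diag_mx !mxE.
Qed.

Lemma coordB P u v i : coord P (u - v) i = coord P u i - coord P v i.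
Proof. by rewrite /coord map_mxB mulmxBr !mxE. Qed.

End SpectralTheorem.

(** * Quadratic forms as weighted sums over the spectrum *)

Section WeightedSums.
Context {R : rcfType} {n : nat}.
Variables (P : 'M[R[i]]_n) (b : 'I_n -> R) (B : 'M[R]_n).
Hypothesis PB : diagonalizes P b B.
Implicit Types u v : 'cV[R]_n.

Lemma sqnorm_weight u : (u^T *m u) 0 0 = \sum_i weight P u i.
Proof.
apply: (@complexI R); rewrite (coord_dot _ _ PB.1) rmorph_sum.
by apply: eq_bigr => i _; rewrite /= weightE mulrC.
Qed.

Lemma laplacian_weight u :
  (u^T *m (u - B *m u)) 0 0 = \sum_i (1 - b i) * weight P u i.
Proof.
apply: (@complexI R); rewrite (coord_dot _ _ PB.1) rmorph_sum.
apply: eq_bigr => i _; rewrite coordB (coord_mul _ _ PB).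
by rewrite rmorphM /= weightE rmorphB /=; ring.
Qed.

Lemma sqnorm_laplacian_weight u :
  ((u - B *m u)^T *m (u - B *m u)) 0 0 = \sum_i (1 - b i) ^+ 2 * weight P u i.
Proof.
rewrite sqnorm_weight; apply: eq_bigr => i _.
apply: (@complexI R); rewrite weightE coordB (coord_mul _ _ PB).
rewrite rmorphM /= weightE -{1 3}(mul1r (coord P u i)) -!mulrBl.
have -> : 1 - (b i)%:C%C = (1 - b i)%:C%C by rewrite rmorphB rmorph1.
rewrite rmorphM /= [X in X * (coord P u i)^*]conj_Creal ?complex_real //.
by rewrite rmorphXn /=; ring.
Qed.

(** Comparing coordinates in [B *m v = v] kills every coordinate of [v] except the one at [k], which
    is then nonzero; orthogonality to [v] therefore forces the [k]-th coordinate of [u] to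
    vanish. *)
Lemma weight_eq0_orthogonal u v k : B *m v = v -> v != 0 ->
    (v^T *m u) 0 0 = 0 -> (forall i, i != k -> b i != 1) ->
  weight P u k = 0.
Proof.
move=> Bv v0 vu bN1.
have cv i : i != k -> coord P v i = 0.
  move=> /bN1 bi1; have := coord_mul v i PB; rewrite Bv => /eqP.
  rewrite -subr_eq0 -{1}(mul1r (coord P v i)) -mulrBl mulf_eq0 => /orP[|/eqP //].
  by rewrite subr_eq0 eq_sym (inj_eq (@complexI R) (b i) 1) (negPf bi1).
have cvk : coord P v k != 0.
  apply: contra v0 => /eqP cvk0.
  have v00 : (v^T *m v) 0 0 = 0.
    apply: (@complexI R); rewrite (coord_dot _ _ PB.1) big1 // => i _.
    by have [->|/cv ->] := eqVneq i k; rewrite ?cvk0 ?mulr0.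
  apply/eqP/colP => i; rewrite mxE; move: v00; rewrite mxE => /eqP.
  rewrite psumr_eq0; last by move=> j _; rewrite mxE -expr2 sqr_ge0.
  by move=> /allP /(_ i); rewrite mem_index_enum mxE mulf_eq0 orbb => /(_ isT)/eqP.
have /(congr1 (real_complex R)) := vu.
rewrite (coord_dot _ _ PB.1) (bigD1 k) //= big1 ?addr0; last first.
  by move=> i /cv ->; rewrite conjC0 mul0r.
move=> /eqP; rewrite mulf_eq0 conjC_eq0 (negPf cvk) /= => /eqP cu.
by apply: (@complexI R); rewrite weightE cu mul0r.
Qed.

End WeightedSums.

(** * Ordered eigenvalues and multiplicities *)

Lemma count_codom_card (T : finType) (S : Type) (f : T -> S) (p : pred S) :
  count p [seq f i | i <- enum T] = #|[pred i | p (f i)]|.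
Proof. by rewrite count_map -size_filter enumT cardE /enum_mem; congr size. Qed.

Section OrderedEigenvalues.
Context {R : realType} {n : nat}.
Variables (P : 'M[R[i]]_n) (b : 'I_n -> R) (B : 'M[R]_n).
Hypothesis PB : diagonalizes P b B.

(** Sorting the diagonal values gives a valid list, so the default of [xget] is never taken; unique
    factorization identifies any other choice up to permutation. *)
Lemma eigenvalues_perm :
  sorted >=%R (eigenvalues B) /\
  perm_eq (eigenvalues B) [seq b i | i <- enum 'I_n].
Proof.
rewrite /eigenvalues; case: xgetP => [s _ [ss cs]|].
  by split=> //; apply: prod_XsubC_eq; rewrite -cs; exact: diagonalizes_char_poly PB.
move=> /(_ (sort >=%R [seq b i | i <- enum 'I_n])) [].
split; first by apply: sort_sorted => x y; exact: ge_total.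
rewrite (diagonalizes_char_poly PB); apply: perm_big.
by rewrite perm_sym perm_sort.
Qed.

Lemma lambda_last_le i : lambda n B <= b i.
Proof.
have [ss ps] := eigenvalues_perm; rewrite /lambda.
have : b i \in eigenvalues B.
  by rewrite (perm_mem ps) map_f // mem_enum.
have sn : size (eigenvalues B) = n by rewrite (perm_size ps) size_map size_enum_ord.
move=> bi; rewrite -(nth_index 0 bi).
have lti : (index (b i) (eigenvalues B) < n)%N by rewrite -[X in (_ < X)%N]sn index_mem.
apply: (sorted_leq_nth ge_trans ge_refl 0 ss); rewrite ?inE ?sn //.
  by rewrite prednK // (leq_ltn_trans _ lti).
by rewrite -ltnS prednK // (leq_ltn_trans _ lti).
Qed.

(** Otherwise two eigenvalues, counted with multiplicity, would exceed the second entry of a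
    nonincreasing list. *)
Lemma lambda2_ge i j : i != j -> b i <= lambda 2 B \/ b j <= lambda 2 B.
Proof.
have [ss ps] := eigenvalues_perm; rewrite /lambda /= => ij.
case: (leP (b i) (eigenvalues B)`_1) => bi; first by left.
case: (leP (b j) (eigenvalues B)`_1) => bj; first by right.
exfalso.
have c2 : (1 < count (> (eigenvalues B)`_1)%R (eigenvalues B))%N.
  rewrite (seq.permP ps) count_codom_card.
  by apply/card_gt1P; exists i, j; rewrite !inE.
move: ss c2; case: (eigenvalues B) => [|x [|y s]] //=; first by case: (_ < _)%R.
rewrite ltxx => /andP[_ ys].
rewrite (eq_in_count (a2 := pred0)) ?count_pred0; first by case: (_ < _).
move=> z zs; have := order_path_min ge_trans ys => /allP /(_ _ zs) /=.
by rewrite ltNge => ->.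
Qed.

(** If [c] were at most the second entry, it would be at most the first two, which come from two
    distinct indices. The bound on [n] ensures that the second entry is not the default 0 of
    [nth]. *)
Lemma lambda2_lt c : (2 <= n)%N ->
  (forall i j, i != j -> b i < c \/ b j < c) -> lambda 2 B < c.
Proof.
move=> n2 bc; have [ss ps] := eigenvalues_perm; rewrite /lambda /= ltNge.
apply/negP => c1.
have : (1 < count (>= c)%R (eigenvalues B))%N.
  have := perm_size ps; rewrite size_map size_enum_ord.
  move: ss c1; case: (eigenvalues B) => [|x [|y s]] /=;
    try by move=> _ _ nE; rewrite -nE in n2.
  by move=> /andP[yx _] cy _; rewrite cy (le_trans cy yx).
rewrite (seq.permP ps) count_codom_card => /card_gt1P[i [j]].
by rewrite !inE => -[ci cj /bc[]]; rewrite ltNge ?ci ?cj.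
Qed.

End OrderedEigenvalues.

(** * Spectral bounds for powers of the communication matrix *)

Section CommunicationSpectrum.
Context {R : realType} {N : nat} {e : rel 'I_N} {W : 'M[R]_N}.
Hypothesis hW : communication_matrix e W.
Implicit Types (t : nat) (u : 'cV[R]_N).

Lemma commX_sym t : (W ^+ t)^T = W ^+ t.
Proof.
elim: t => [|t IHt]; first by rewrite expr0 trmx1.
by rewrite exprS trmx_mul IHt (comm_sym hW) -[_ *m _]exprSr exprS.
Qed.

Lemma commX_ge0 t i j : 0 <= (W ^+ t) i j.
Proof.
elim: t i j => [|t IHt] i j; first by rewrite expr0 mxE ler0n.
by rewrite exprS mxE sumr_ge0 // => k _; rewrite mulr_ge0 ?IHt ?(comm_ge0 hW).
Qed.

Lemma commX_row t i : \sum_j (W ^+ t) i j = 1.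
Proof.
elim: t i => [|t IHt] i.
  rewrite expr0 (bigD1 i) //= mxE eqxx big1 ?addr0 // => j ji.
  by rewrite mxE eq_sym (negPf ji).
rewrite exprS; under eq_bigr do rewrite mxE.
rewrite exchange_big /=; under eq_bigr do rewrite -mulr_sumr IHt mulr1.
exact: comm_row hW i.
Qed.

Lemma commX_symE t i j : (W ^+ t) i j = (W ^+ t) j i.
Proof. by rewrite -{1}commX_sym mxE. Qed.

Lemma diagonalizes_eigenvalue (P : 'M[R[i]]_N) a i :
  diagonalizes P a W -> eigenvalue W (a i).
Proof.
move=> PW; rewrite eigenvalue_root_char (diagonalizes_char_poly PW).
by rewrite root_prod_XsubC map_f // mem_enum.
Qed.

(** As [W] is symmetric, [sigma 2 W] is the square root of the second eigenvalue of [W ^+ 2], so at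
    most one eigenvalue of [W] can have modulus at least 1. *)
Lemma comm_sqr_lt1 (P : 'M[R[i]]_N) a i j : diagonalizes P a W ->
  i != j -> a i ^+ 2 < 1 \/ a j ^+ 2 < 1.
Proof.
move=> PW ij.
have l2 : lambda 2 (W ^+ 2) < 1.
  have /andP[_] := comm_sigma2 hW; rewrite /sigma (comm_sym hW) -[_ *m _]expr2.
  by rewrite ltNge => /negP s1; rewrite ltNge; apply/negP => /ler_wsqrtr; rewrite sqrtr1.
have [h|h] := lambda2_ge (diagonalizesX 2 PW) ij.
  by left; apply: le_lt_trans l2.
by right; apply: le_lt_trans l2.
Qed.

Lemma expr_lt1_of_sqr (z : R) t : (0 < t)%N -> z ^+ 2 < 1 -> z ^+ t < 1.
Proof.
move=> t0; rewrite -real_normK ?num_real // expr_lt1 // => z1.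
by rewrite (le_lt_trans (ler_norm _)) // normrX exprn_ilt1 // -lt0n.
Qed.

Lemma mu_gt0 t : (2 <= N)%N -> (0 < t)%N -> 0 < mu W t.
Proof.
move=> N2 t0; rewrite subr_gt0.
have [P [a PW]] := symmetric_diagonalizes (comm_sym hW).
apply: (lambda2_lt (diagonalizesX t PW)) => // i j ij.
by case: (comm_sqr_lt1 PW ij) => /(expr_lt1_of_sqr t0); [left | right].
Qed.

(** Termwise in the eigenbasis this is (1 - b)^2 <= L (1 - b), which holds for each eigenvalue b of
    [W ^+ t] because 0 <= 1 - b <= L. *)
Lemma laplacian_upper t u :
  ((u - W ^+ t *m u)^T *m (u - W ^+ t *m u)) 0 0
    <= Lip W t * (u^T *m (u - W ^+ t *m u)) 0 0.
Proof.
have [P [a PW]] := symmetric_diagonalizes (comm_sym hW).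
have PV := diagonalizesX t PW.
rewrite (sqnorm_laplacian_weight PV) (laplacian_weight PV) mulr_sumr.
apply: ler_sum => i _; rewrite [leRHS]mulrA ler_wpM2r ?weight_ge0 //.
have /andP[aN1 a1] := comm_eig hW (diagonalizes_eigenvalue i PW).
rewrite expr2 ler_wpM2r ?lerB ?(lambda_last_le PV) // subr_ge0.
by rewrite (le_trans (ler_norm _)) // normrX exprn_ile1 // ler_norml a1 ltW.
Qed.

Lemma laplacian_gap t u : (2 <= N)%N -> (0 < t)%N -> \sum_i u i 0 = 0 ->
  mu W t * (u^T *m u) 0 0 <= (u^T *m (u - W ^+ t *m u)) 0 0.
Proof.
move=> N2 t0 su; have m0 := mu_gt0 N2 t0.
have [P [a PW]] := symmetric_diagonalizes (comm_sym hW).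
have PV := diagonalizesX t PW.
rewrite (sqnorm_weight PV) (laplacian_weight PV) mulr_sumr.
apply: ler_sum => i _.
have [le_i|lt_i] := leP (a i ^+ t) (lambda 2 (W ^+ t)).
  by rewrite ler_wpM2r ?weight_ge0 // lerB.
(* Here [i] is the only index whose eigenvalue exceeds [lambda 2], and the others stay below 1 by
   [mu_gt0]. The fixed vector of ones, orthogonal to [u], is thus carried by coordinate [i]
   alone. *)
suff -> : weight P u i = 0 by rewrite !mulr0.
apply: (@weight_eq0_orthogonal _ _ _ _ _ PV u (const_mx 1)).
- apply/colP => j; rewrite !mxE -[RHS](commX_row t j).
  by apply: eq_bigr => k _; rewrite mxE mulr1.
- apply/eqP => /colP /(_ i); rewrite !mxE; apply/eqP; exact: oner_neq0.
- by rewrite mxE -[RHS]su; apply: eq_bigr => k _; rewrite !mxE mul1r.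
move=> j ji; have [|le_j] := lambda2_ge PV ji; last by rewrite leNgt lt_i in le_j.
by move=> /le_lt_trans h; rewrite lt_eqF // h // -subr_gt0.
Qed.

End CommunicationSpectrum.

(** * Frobenius inner product and trace inequalities *)

Section FrobeniusTheory.
Context {R : realType}.

Lemma finnerE m n (A B : 'M[R]_(m, n)) :
  finner A B = \sum_i \sum_j A i j * B i j.
Proof.
rewrite exchange_big; apply: eq_bigr => j _; rewrite mxE.
by apply: eq_bigr => i _; rewrite mxE.
Qed.

Lemma finnerC m n (A B : 'M[R]_(m, n)) : finner A B = finner B A.
Proof. by rewrite /finner -mxtrace_tr trmx_mul trmxK. Qed.

Lemma finnerBr m n (A B C : 'M[R]_(m, n)) :
  finner A (B - C) = finner A B - finner A C.
Proof. by rewrite /finner mulmxBr raddfB. Qed.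

Lemma finnerBl m n (A B C : 'M[R]_(m, n)) :
  finner (A - B) C = finner A C - finner B C.
Proof. by rewrite finnerC finnerBr ![finner C _]finnerC. Qed.

Lemma finnerZr m n c (A B : 'M[R]_(m, n)) : finner A (c *: B) = c * finner A B.
Proof. by rewrite /finner -scalemxAr mxtraceZ. Qed.

Lemma finnerZl m n c (A B : 'M[R]_(m, n)) : finner (c *: A) B = c * finner A B.
Proof. by rewrite finnerC finnerZr finnerC. Qed.

Lemma finner_sumr m n (I : finType) A (F : I -> 'M[R]_(m, n)) :
  finner A (\sum_i F i) = \sum_i finner A (F i).
Proof. by rewrite /finner mulmx_sumr raddf_sum. Qed.

Lemma finner_ge0 m n (A : 'M[R]_(m, n)) : 0 <= finner A A.
Proof.
rewrite finnerE !sumr_ge0 // => i _; rewrite sumr_ge0 // => j _.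
by rewrite -expr2 sqr_ge0.
Qed.

Lemma fnorm_sqr m n (A : 'M[R]_(m, n)) : fnorm A ^+ 2 = finner A A.
Proof. by rewrite sqr_sqrtr ?finner_ge0. Qed.

Lemma stack_norm_sqr N m n (x : 'I_N -> 'M[R]_(m, n)) :
  stack_norm x ^+ 2 = \sum_i finner (x i) (x i).
Proof. by rewrite sqr_sqrtr // sumr_ge0 // => i _; exact: finner_ge0. Qed.

(** By Lagrange's identity: the nonnegative double sum is twice the difference of the two sides. *)
Lemma cauchy_schwarz (I : finType) (x y : I -> R) :
  (\sum_i x i * y i) ^+ 2 <= (\sum_i x i ^+ 2) * (\sum_i y i ^+ 2).
Proof.
have : 0 <= \sum_i \sum_j (x i * y j - x j * y i) ^+ 2.
  by apply: sumr_ge0 => i _; apply: sumr_ge0 => j _; exact: sqr_ge0.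
have E : \sum_i \sum_j (x i * y j - x j * y i) ^+ 2 =
    \sum_i \sum_j x i ^+ 2 * y j ^+ 2 + \sum_i \sum_j y i ^+ 2 * x j ^+ 2
    - 2 * \sum_i \sum_j (x i * y i) * (x j * y j).
  rewrite mulr_sumr -big_split -sumrB /=; apply: eq_bigr => i _.
  rewrite mulr_sumr -big_split -sumrB /=; apply: eq_bigr => j _; ring.
rewrite E -!big_distrlr /= expr2; lra.
Qed.

Lemma finner_mulmx_le m n p (A : 'M[R]_(m, n)) (B : 'M[R]_(n, p)) :
  finner (A *m B) (A *m B) <= finner A A * finner B B.
Proof.
have -> : finner B B = \sum_j \sum_k B k j ^+ 2.
  by rewrite finnerE exchange_big; do 2!apply: eq_bigr => ? _; rewrite expr2.
have -> : finner A A = \sum_i \sum_k A i k ^+ 2.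
  by rewrite finnerE; do 2!apply: eq_bigr => ? _; rewrite expr2.
rewrite finnerE big_distrlr /=; apply: ler_sum => i _; apply: ler_sum => j _.
by rewrite -expr2 mxE; exact: cauchy_schwarz.
Qed.

(** The left-hand side is the squared Frobenius norm of [A *m B^T], so submultiplicativity
    applies. *)
Lemma mxtrace_gram_le m n p (A : 'M[R]_(m, n)) (B : 'M[R]_(p, n)) :
  \tr ((A^T *m A) *m (B^T *m B)) <= finner A A * finner B B.
Proof.
have -> : finner B B = finner B^T B^T.
  by rewrite /finner trmxK mxtrace_mulC.
apply: le_trans (finner_mulmx_le _ _).
by rewrite /finner trmx_mul trmxK -!mulmxA [leRHS]mxtrace_mulC !mulmxA.
Qed.

End FrobeniusTheory.

(** * Tangent projection and chords of the Stiefel manifold *)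

Section StiefelTheory.
Context {R : realType} {d r : nat}.
Implicit Types (y z : 'M[R]_(d, r)).

(** The squared norm drops by exactly tr(S^2) / 4: a trace against the symmetric [S] only sees the
    symmetric part [S] / 2 of [y^T *m z]. *)
Lemma tangent_proj_le y z : stiefel y ->
  finner (tangent_proj y z) (tangent_proj y z) <= finner z z.
Proof.
move=> yS; rewrite /tangent_proj; set S := y^T *m z + z^T *m y.
have ST : S^T = S by rewrite linearD /= !trmx_mul !trmxK addrC.
have zS : finner z (y *m S) = 2^-1 * \tr (S *m S).
  have e1 : finner z (y *m S) = \tr ((z^T *m y) *m S) by rewrite /finner mulmxA.
  have e2 : finner z (y *m S) = \tr ((y^T *m z) *m S).
    by rewrite e1 -mxtrace_tr !trmx_mul trmxK ST mxtrace_mulC.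
  have : finner z (y *m S) + finner z (y *m S) = \tr (S *m S).
    by rewrite {1}e2 e1 -mxtraceD -mulmxDl.
  lra.
have SS : finner (y *m S) (y *m S) = \tr (S *m S).
  by rewrite /finner trmx_mul -mulmxA (mulmxA _ y) yS mul1mx ST.
have S0 : 0 <= \tr (S *m S) by rewrite -{1}ST finner_ge0.
by rewrite !finnerBl !finnerBr !finnerZl !finnerZr (finnerC _ z) SS zS; lra.
Qed.

(** The Gram matrix of [y - z] is the sum of 1 - z^T y and its transpose, which have equal traces
    against the symmetric [M]; the left-hand side is one of these traces. *)
Lemma finner_sub_stiefel y z (M : 'M[R]_r) : stiefel y -> stiefel z -> M^T = M ->
  finner (y - z) (y *m M) = 2^-1 * \tr (((y - z)^T *m (y - z)) *m M).
Proof.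
move=> yS zS MT.
have trB : (y - z)^T = y^T - z^T by rewrite linearB.
have -> : (y - z)^T *m (y - z) = (1%:M - z^T *m y) + (1%:M - y^T *m z).
  rewrite trB mulmxBl !mulmxBr yS zS opprB addrACA [RHS]addrACA.
  by rewrite [- _ - _]addrC.
rewrite mulmxDl mxtraceD.
have -> : \tr ((1%:M - y^T *m z) *m M) = \tr ((1%:M - z^T *m y) *m M).
  by rewrite -mxtrace_tr trmx_mul MT linearB /= trmx1 trmx_mul trmxK mxtrace_mulC.
rewrite /finner trB mulmxBl !mulmxA yS -mulmxBl; lra.
Qed.

End StiefelTheory.

(** * Bounds on the Euclidean and Riemannian gradients of [phi] *)

Section ConsensusGradient.
Context {R : realType} {N d r : nat} {e : rel 'I_N} {W : 'M[R]_N}.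
Hypothesis hW : communication_matrix e W.
Implicit Types (t : nat) (x : 'I_N -> 'M[R]_(d, r)) (xbar : 'M[R]_(d, r)).

Lemma sum_commXl t (f : 'I_N -> R) :
  \sum_i \sum_j (W ^+ t) i j * f i = \sum_i f i.
Proof.
by apply: eq_bigr => i _; rewrite -mulr_suml (commX_row hW) mul1r.
Qed.

Lemma sum_commXr t (f : 'I_N -> R) :
  \sum_i \sum_j (W ^+ t) i j * f j = \sum_i f i.
Proof.
rewrite exchange_big -[RHS](sum_commXl t).
by do 2!apply: eq_bigr => ? _; rewrite (commX_symE hW).
Qed.

Lemma phi_ge0 t x : 0 <= phi W t x.
Proof.
rewrite mulr_ge0 ?invr_ge0 //; do 2!apply: sumr_ge0 => ? _.
by rewrite mulr_ge0 ?(commX_ge0 hW) ?sqr_ge0.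
Qed.

Lemma inner_egrad_phi t x : stack_inner x (egrad_phi W t x) = 2 * phi W t x.
Proof.
rewrite /stack_inner /phi.
under eq_bigr do rewrite finnerBr finner_sumr.
have -> : \sum_i \sum_j (W ^+ t) i j * fnorm (x i - x j) ^+ 2 =
    \sum_i \sum_j (W ^+ t) i j * finner (x i) (x i)
    + \sum_i \sum_j (W ^+ t) i j * finner (x j) (x j)
    - 2 * \sum_i \sum_j (W ^+ t) i j * finner (x i) (x j).
  rewrite mulr_sumr -big_split -sumrB; apply: eq_bigr => i _ /=.
  rewrite mulr_sumr -big_split -sumrB; apply: eq_bigr => j _ /=.
  by rewrite fnorm_sqr finnerBl !finnerBr (finnerC (x j)); ring.
rewrite sum_commXl sum_commXr sumrB.
under [X in _ - X]eq_bigr => i _ do under eq_bigr => j _ do rewrite finnerZr.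
by field.
Qed.

Lemma sum_egrad_phi t x : \sum_i egrad_phi W t x i = 0.
Proof.
rewrite sumrB exchange_big /= -sumrB big1 // => j _.
rewrite -scaler_suml; under eq_bigr do rewrite (commX_symE hW).
by rewrite (commX_row hW) scale1r subrr.
Qed.

Lemma inner_dev_egrad_phi t x xbar :
  stack_inner (dev x xbar) (egrad_phi W t x) = 2 * phi W t x.
Proof.
rewrite -inner_egrad_phi /stack_inner.
under eq_bigr do rewrite finnerBl.
by rewrite sumrB -finner_sumr sum_egrad_phi /finner mulmx0 mxtrace0 subr0.
Qed.

Lemma rgrad_phiE t x i : (forall i, stiefel (x i)) ->
  rgrad_phi W t x i = egrad_phi W t x i - 2^-1 *:
    (x i *m \sum_j (W ^+ t) i j *: ((x i - x j)^T *m (x i - x j))).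
Proof.
move=> xS; rewrite /rgrad_phi /tangent_proj; congr (_ - _ *: (_ *m _)).
have eE : egrad_phi W t x i = \sum_j (W ^+ t) i j *: (x i - x j).
  under eq_bigr do rewrite scalerBr.
  by rewrite sumrB -scaler_suml (commX_row hW) scale1r.
rewrite eE mulmx_sumr [X in _ + X *m _]linear_sum mulmx_suml -big_split /=.
apply: eq_bigr => j _.
rewrite -scalemxAr [X in _ + X *m _]linearZ /= -scalemxAl -scalerDr; congr (_ *: _).
have trB : (x i - x j)^T = (x i)^T - (x j)^T by rewrite linearB.
by rewrite trB !mulmxBl !mulmxBr !xS opprB.
Qed.

(** The uniform bound [c] serves both regions: it is taken to be the square of the maximum norm in
    one and of the stacked norm in the other. *)
Lemma inner_dev_rgrad_phi t x xbar c :
    (forall i, stiefel (x i)) -> stiefel xbar ->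
    (forall i, fnorm (dev x xbar i) ^+ 2 <= c) ->
  (2 - c) * phi W t x <= stack_inner (dev x xbar) (rgrad_phi W t x).
Proof.
move=> xS xbS xc.
rewrite /stack_inner; under eq_bigr do
  rewrite (rgrad_phiE _ _ xS) finnerBr finnerZr.
rewrite sumrB -/(stack_inner _ _) inner_dev_egrad_phi mulrBl lerB //.
rewrite /phi [leRHS]mulrCA mulr_sumr mulr_sumr.
apply: ler_sum => i _.
set M := \sum_j _.
have MT : M^T = M.
  by rewrite linear_sum; apply: eq_bigr => j _; rewrite linearZ /= trmx_mul trmxK.
rewrite finner_sub_stiefel // [leLHS]mulrA.
(* One half comes from the tangent projection, the other from [finner_sub_stiefel]; together they
   match the factor 1/4 in [phi]. *)
have -> : 2^-1 * 2^-1 = 4^-1 :> R by field.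
rewrite ler_wpM2l ?invr_ge0 //.
rewrite mulmx_sumr raddf_sum mulr_sumr; apply: ler_sum => j _ /=.
rewrite -scalemxAr mxtraceZ mulrCA ler_wpM2l ?(commX_ge0 hW) //.
apply: le_trans (mxtrace_gram_le _ _) _.
by rewrite -!fnorm_sqr ler_wpM2r ?sqr_ge0 //; exact: xc.
Qed.

Lemma mulmx_commX_col t x a b i :
  let u := \col_k x k a b in (u - W ^+ t *m u) i 0 = egrad_phi W t x i a b.
Proof.
rewrite /= !mxE summxE; congr (_ - _); apply: eq_bigr => j _.
by rewrite !mxE.
Qed.

(** Splits the stacked problem into one vector problem per matrix entry, where the bounds for the
    action of [W ^+ t] on ['cV[R]_N] apply. *)
Lemma stack_inner_cols x y : stack_inner x y =
  \sum_a \sum_b ((\col_k x k a b)^T *m (\col_k y k a b)) 0 0.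
Proof.
rewrite /stack_inner; under eq_bigr do rewrite finnerE.
rewrite exchange_big; apply: eq_bigr => a _.
rewrite exchange_big; apply: eq_bigr => b _; rewrite mxE.
by apply: eq_bigr => k _; rewrite !mxE.
Qed.

Lemma col_egrad_phi t x a b :
  \col_k egrad_phi W t x k a b = \col_k x k a b - W ^+ t *m \col_k x k a b.
Proof. by apply/colP => i; rewrite mulmx_commX_col mxE. Qed.

Lemma egrad_phi_le t x :
  stack_inner (egrad_phi W t x) (egrad_phi W t x) <= 2 * Lip W t * phi W t x.
Proof.
rewrite mulrAC -inner_egrad_phi mulrC !stack_inner_cols mulr_sumr.
apply: ler_sum => a _; rewrite mulr_sumr; apply: ler_sum => b _.
by rewrite col_egrad_phi; exact: laplacian_upper hW t _.
Qed.

Lemma rgrad_phi_le t x : (forall i, stiefel (x i)) ->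
  stack_norm (rgrad_phi W t x) ^+ 2 <= 2 * Lip W t * phi W t x.
Proof.
move=> xS; apply: le_trans (egrad_phi_le t x).
by rewrite stack_norm_sqr; apply: ler_sum => i _; exact: tangent_proj_le.
Qed.

Definition mean x : 'M[R]_(d, r) := N%:R^-1 *: \sum_i x i.

Lemma sum_dev_mean x : (2 <= N)%N -> \sum_i dev x (mean x) i = 0.
Proof.
move=> N2; rewrite sumrB sumr_const card_ord -scaler_nat scalerA divff ?scale1r ?subrr //.
by rewrite pnatr_eq0; case: (N) N2.
Qed.

Lemma egrad_phi_dev t x y : egrad_phi W t (dev x y) =1 egrad_phi W t x.
Proof.
move=> i; rewrite /egrad_phi /dev.
under eq_bigr do rewrite scalerBr.
by rewrite sumrB -scaler_suml (commX_row hW) scale1r opprB addrA subrK.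
Qed.

(** Recentring at [mean x] leaves the gradient unchanged and makes each entry vector sum to zero, as
    [laplacian_gap] requires. *)
Lemma phi_gap t x : (2 <= N)%N -> (0 < t)%N ->
  mu W t * stack_norm (dev x (mean x)) ^+ 2 <= 2 * phi W t x.
Proof.
move=> N2 t0; rewrite -(inner_dev_egrad_phi t x (mean x)).
rewrite stack_norm_sqr -/(stack_inner _ _).
rewrite !stack_inner_cols mulr_sumr.
apply: ler_sum => a _; rewrite mulr_sumr; apply: ler_sum => b _.
have -> : \col_k egrad_phi W t x k a b = \col_k egrad_phi W t (dev x (mean x)) k a b.
  by apply/colP => i; rewrite mxE [RHS]mxE egrad_phi_dev.
rewrite col_egrad_phi; apply: (laplacian_gap hW N2 t0).
transitivity ((\sum_i dev x (mean x) i) a b); last by rewrite sum_dev_mean // mxE.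
by rewrite summxE; apply: eq_bigr => i _; rewrite mxE.
Qed.

End ConsensusGradient.

(** * Optimality of the IAM and its distance to the Euclidean mean *)

Section InducedArithmeticMean.
Context {R : realType} {N d r : nat}.
Implicit Types (x : 'I_N -> 'M[R]_(d, r)) (xbar : 'M[R]_(d, r)).

(* y |-> (1 + s K + (1 - c) K^2) y is Rodrigues' rotation formula with
   s = sin and c = cos of the angle. *)
Lemma stiefel_rotation (K : 'M[R]_d) (y : 'M[R]_(d, r)) (s c : R) :
    K^T = - K -> K *m K *m K = - K -> s ^+ 2 + c ^+ 2 = 1 -> stiefel y ->
  stiefel (y + s *: (K *m y) + (1 - c) *: (K *m K *m y)).
Proof.
move=> KT K3 sc yS; pose Q := 1%:M + s *: K + (1 - c) *: (K *m K).
have -> : y + s *: (K *m y) + (1 - c) *: (K *m K *m y) = Q *m y.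
  by rewrite /Q !mulmxDl mul1mx -!scalemxAl.
have QT : Q^T = 1%:M - s *: K + (1 - c) *: (K *m K).
  rewrite /Q !linearD /= !linearZ /= trmx1 trmx_mul KT mulmxN mulNmx opprK.
  by rewrite scalerN.
have K4 : K *m K *m (K *m K) = - (K *m K) by rewrite mulmxA K3 mulNmx.
have K3' : K *m (K *m K) = - K by rewrite mulmxA.
suff QQ : Q^T *m Q = 1%:M.
  by rewrite /stiefel trmx_mul -mulmxA (mulmxA _ Q) QQ mul1mx.
rewrite QT /Q !mulmxDl !mulmxDr !mulNmx !mul1mx !mulmx1 -!scalemxAl -!scalemxAr.
rewrite K3 K3' K4; move: (K *m K) => L; apply/matrixP => i j; rewrite !mxE.
transitivity ((i == j)%:R + L i j * (1 - (s ^+ 2 + c ^+ 2))); first ring.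
by rewrite sc subrr mulr0 addr0.
Qed.

(** As y^T y = 1 fixes the norm of [y], minimizing the distances amounts to maximizing a linear
    functional. *)
Lemma sum_dist_stiefel x y : stiefel y -> \sum_i fnorm (y - x i) ^+ 2 =
  N%:R * r%:R - 2 * finner y (\sum_i x i) + \sum_i finner (x i) (x i).
Proof.
move=> yS; have yy : finner y y = r%:R by rewrite /finner yS mxtrace1.
rewrite finner_sumr mulr_sumr.
have -> : N%:R * r%:R = \sum_(i < N) r%:R :> R.
  by rewrite sumr_const card_ord mulr_natl.
rewrite -sumrB -big_split; apply: eq_bigr => i _ /=.
by rewrite fnorm_sqr finnerBl !finnerBr (finnerC (x i)) yy; ring.
Qed.

(** First-order optimality along the rotations generated by [K], obtained without derivatives from
    an inequality quadratic in the tangent [h] of the half angle. *)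
Lemma IAM_skew x xbar (K : 'M[R]_d) : is_IAM x xbar ->
  K^T = - K -> K *m K *m K = - K -> finner (K *m xbar) (\sum_i x i) = 0.
Proof.
move=> [bS bmin] KT K3.
pose a := finner (K *m K *m xbar) (\sum_i x i).
pose b := finner (K *m xbar) (\sum_i x i).
(* Rational parametrization of the rotations generated by K. *)
have ab h : h * b + h ^+ 2 * a <= 0.
  have h1 : 1 + h ^+ 2 != 0 by rewrite gt_eqF // ltr_pwDl // sqr_ge0.
  pose s := 2 * h / (1 + h ^+ 2); pose c := (1 - h ^+ 2) / (1 + h ^+ 2).
  have sc : s ^+ 2 + c ^+ 2 = 1 by rewrite /s /c; field.
  have yS := stiefel_rotation KT K3 sc bS.
  have := bmin _ yS; rewrite !sum_dist_stiefel // lerD2r lerD2l lerN2.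
  rewrite ler_pM2l // ![finner (_ + _) _]finnerC /finner !mulmxDr !mxtraceD.
  rewrite -/(finner _ _) -/(finner _ (_ *: _)) -/(finner _ ((1 - c) *: _)).
  rewrite !finnerZr ![finner (\sum_i _) _]finnerC -/a -/b => le0.
  have : s * b + (1 - c) * a <= 0 by lra.
  have -> : s * b + (1 - c) * a = 2 / (1 + h ^+ 2) * (h * b + h ^+ 2 * a).
    by rewrite /s /c; field.
  by rewrite pmulr_rle0 // divr_gt0 // ltr_pwDl // sqr_ge0.
apply/eqP; rewrite -/b -sqrf_eq0 eq_le sqr_ge0 andbT.
have a1 : a ^+ 2 + 1 != 0 by rewrite gt_eqF // ltr_wpDl // sqr_ge0.
(* This [h] turns the inequality into a positive multiple of [b ^+ 2] being nonpositive, since a^2 +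
   a + 1 > 0. *)
have := ab (b / (a ^+ 2 + 1)).
have -> : b / (a ^+ 2 + 1) * b + (b / (a ^+ 2 + 1)) ^+ 2 * a =
    (a ^+ 2 + a + 1) / (a ^+ 2 + 1) ^+ 2 * b ^+ 2 by field.
rewrite pmulr_rle0 // divr_gt0 //; last by rewrite exprn_even_gt0.
by have := sqr_ge0 (a + 2^-1); rewrite sqrrD; nra.
Qed.

Lemma mxtrace_delta_mul n (p q : 'I_n) (M : 'M[R]_n) :
  \tr (delta_mx p q *m M) = M q p.
Proof.
rewrite /mxtrace (bigD1 p) //= [X in _ + X]big1 => [|i ip].
  rewrite addr0 mxE (bigD1 q) //= big1 => [|k kq].
    by rewrite mxE !eqxx mul1r addr0.
  by rewrite mxE (negPf kq) andbF mul0r.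
by rewrite mxE big1 // => k _; rewrite mxE (negPf ip) mul0r.
Qed.

Lemma IAM_sym x xbar : is_IAM x xbar ->
  (\sum_i x i) *m xbar^T = xbar *m (\sum_i x i)^T.
Proof.
move=> xI; set S := \sum_i x i; apply/matrixP => p q.
have -> : xbar *m S^T = (S *m xbar^T)^T by rewrite trmx_mul trmxK.
rewrite [RHS]mxE; have [->//|pq] := eqVneq p q.
(* Generator of the rotations in the (p, q) coordinate plane; its square is minus the projection
   onto that plane. Stationarity along it equates the (p, q) and (q, p) entries. *)
pose K : 'M[R]_d := delta_mx p q - delta_mx q p.
have KT : K^T = - K by rewrite linearB /= !trmx_delta opprB.
have qp : (q == p) = false by rewrite eq_sym (negPf pq).
have K2 : K *m K = - (delta_mx p p + delta_mx q q).
  rewrite /K !mulmxBl !mulmxBr !mul_delta_mx_cond !eqxx (negPf pq) qp.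
  by rewrite !mulr0n !mulr1n sub0r subr0 opprD.
have K3 : K *m K *m K = - K.
  rewrite K2 mulNmx mulmxDl /K !mulmxBr !mul_delta_mx_cond !eqxx (negPf pq) qp.
  by rewrite !mulr0n !mulr1n subr0 sub0r.
have := IAM_skew xI KT K3.
have -> : K *m xbar = delta_mx p q *m xbar - delta_mx q p *m xbar by rewrite mulmxBl.
have dE (k l : 'I_d) : finner (delta_mx k l *m xbar) S = (S *m xbar^T) k l.
  by rewrite /finner trmx_mul trmx_delta -mulmxA mxtrace_mulC -mulmxA mxtrace_delta_mul.
by rewrite finnerBl !dE => /eqP; rewrite subr_eq0 => /eqP.
Qed.

(** A polar-type factorization with symmetric factor [xbar^T *m S], obtained by multiplying
    [IAM_sym] on the right by [xbar]. *)
Lemma IAM_polar x xbar (S := \sum_i x i) : is_IAM x xbar ->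
  (xbar^T *m S)^T = xbar^T *m S /\ S = xbar *m (xbar^T *m S).
Proof.
move=> xI; have E := IAM_sym xI; have bS : xbar^T *m xbar = 1%:M by case: xI.
have SE : S = xbar *m (S^T *m xbar) by rewrite mulmxA -E -mulmxA bS mulmx1.
have HT : (xbar^T *m S)^T = xbar^T *m S.
  by rewrite trmx_mul trmxK [in RHS]SE mulmxA bS mul1mx.
by split=> //; rewrite -HT trmx_mul trmxK.
Qed.

Lemma IAM_mean_dist x xbar : (0 < N)%N -> is_IAM x xbar ->
    (forall i, stiefel (x i)) ->
  finner (xbar - mean x) (xbar - mean x)
    <= (4 * N%:R ^+ 2)^-1 * (stack_norm (dev x xbar) ^+ 2) ^+ 2.
Proof.
move=> N0 xI xS; have N0' : N%:R != 0 :> R by rewrite pnatr_eq0 -lt0n.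
have [HT SE] := IAM_polar xI; have bS : xbar^T *m xbar = 1%:M by case: xI.
pose G := \sum_i (dev x xbar i)^T *m dev x xbar i.
have GE : G = 2 *: (N%:R *: 1%:M - xbar^T *m \sum_i x i).
  rewrite scaler_nat mulr2n -{2}HT trmx_mul trmxK [(\sum_i x i)^T]linear_sum.
  have -> : N%:R *: 1%:M = \sum_(i < N) 1%:M :> 'M[R]_r.
    by rewrite sumr_const card_ord scaler_nat.
  rewrite mulmx_sumr mulmx_suml /= -!sumrB.
  rewrite -big_split; apply: eq_bigr => i _ /=.
  have trB : (dev x xbar i)^T = (x i)^T - xbar^T by rewrite linearB.
  rewrite trB /dev mulmxBl !mulmxBr bS xS opprB addrACA [RHS]addrACA.
  by rewrite [- _ - _]addrC.
have -> : xbar - mean x = (2 * N%:R)^-1 *: (xbar *m G).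
  rewrite GE -scalemxAr mulmxBr -scalemxAr mulmx1 -SE scalerA.
  rewrite (_ : _ * 2 = N%:R^-1); last by field.
  by rewrite scalerBr scalerA mulVf ?scale1r.
have GT : G^T = G.
  by rewrite linear_sum /=; apply: eq_bigr => i _; rewrite trmx_mul trmxK.
have -> : finner ((2 * N%:R)^-1 *: (xbar *m G)) ((2 * N%:R)^-1 *: (xbar *m G)) =
    (4 * N%:R ^+ 2)^-1 * \tr (G *m G).
  rewrite finnerZl finnerZr mulrA; congr (_ * _); first by field.
  by rewrite /finner trmx_mul -mulmxA (mulmxA _ xbar) bS mul1mx GT.
rewrite ler_wpM2l ?invr_ge0 ?mulr_ge0 ?sqr_ge0 //.
(* Both sides expand into double sums, compared term by term by [mxtrace_gram_le]. *)
rewrite stack_norm_sqr expr2 big_distrlr /= mulmx_suml raddf_sum.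
apply: ler_sum => i _; rewrite mulmx_sumr raddf_sum; apply: ler_sum => j _.
exact: mxtrace_gram_le.
Qed.

(** Parallel axis identity: the cross term vanishes because deviations from the mean sum to zero. *)
Lemma stack_norm_dev_mean x y : (2 <= N)%N ->
  stack_norm (dev x y) ^+ 2 =
  stack_norm (dev x (mean x)) ^+ 2 + N%:R * finner (y - mean x) (y - mean x).
Proof.
move=> N2; rewrite !stack_norm_sqr.
have -> : N%:R * finner (y - mean x) (y - mean x) =
    \sum_(i < N) finner (y - mean x) (y - mean x).
  by rewrite sumr_const card_ord mulr_natl.
have z : \sum_i finner (y - mean x) (dev x (mean x) i) = 0.
  by rewrite -finner_sumr sum_dev_mean // /finner mulmx0 mxtrace0.
rewrite -[RHS]subr0 -[X in _ = _ - X](mulr0 2) -[X in 2 * X]z.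
rewrite mulr_sumr -big_split -sumrB.
apply: eq_bigr => i _ /=.
have -> : dev x y i = dev x (mean x) i - (y - mean x) by rewrite /dev opprB addrA subrK.
move: (y - mean x) (dev x _ i) => v w.
by rewrite finnerBl !finnerBr (finnerC w v); ring.
Qed.

(** With D the squared deviation from [xbar], the parallel axis term is at most D^2 / (4N), and one
    factor D is bounded by N delta^2. *)
Lemma stack_norm_dev_mean_ge x xbar delta : (2 <= N)%N -> is_IAM x xbar ->
    (forall i, stiefel (x i)) ->
    stack_norm (dev x xbar) ^+ 2 <= N%:R * delta ^+ 2 ->
  (1 - delta ^+ 2 / 4) * stack_norm (dev x xbar) ^+ 2
    <= stack_norm (dev x (mean x)) ^+ 2.
Proof.
move=> N2 xI xS xd; have N0 : (0 < N)%N by apply: leq_trans N2.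
have N0' : 0 < N%:R :> R by rewrite ltr0n.
have := IAM_mean_dist N0 xI xS; have := stack_norm_dev_mean x xbar N2.
set D := stack_norm (dev x xbar) ^+ 2 in xd *; set f := finner _ _ => DE fle.
have D0 : 0 <= D by exact: sqr_ge0.
suff : N%:R * f <= delta ^+ 2 / 4 * D by rewrite DE; lra.
apply: (@le_trans _ _ (N%:R * ((4 * N%:R ^+ 2)^-1 * D ^+ 2))).
  by rewrite ler_wpM2l // ltW.
have -> : N%:R * ((4 * N%:R ^+ 2)^-1 * D ^+ 2) = D / N%:R / 4 * D.
  by field; rewrite gt_eqF.
rewrite ler_wpM2r // ler_wpM2r ?invr_ge0 // ler_pdivrMr //; lra.
Qed.

End InducedArithmeticMean.

(** * Combination of the bounds in the two regions *)

Lemma fnorm_dev_le (R : realType) (N d r : nat) (x : 'I_N -> 'M[R]_(d, r))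
    (y : 'M[R]_(d, r)) i :
  fnorm (dev x y i) <= stack_norm_inf (dev x y) /\
  fnorm (dev x y i) <= stack_norm (dev x y).
Proof.
split; first exact: (le_bigmax _ (fun j => fnorm (dev x y j))).
rewrite ler_wsqrtr // /stack_inner (bigD1 i) //= lerDl sumr_ge0 // => j _.
exact: finner_ge0.
Qed.

Theorem proposition4 (R : realType) (N d r : nat)
    (hr : (1 <= r <= d)%N) (hN : (2 <= N)%N)
    (e : rel 'I_N) (he : connected_graph e)
    (W : 'M[R]_N) (hW : communication_matrix e W)
    (t : nat) (ht : (1 <= t)%N)
    (delta1 delta2 delta3 : R)
    (hdR : admissible_R (r := r) delta1 delta2)
    (hdl : admissible_l (N := N) (r := r) delta3)
    (x : 'I_N -> 'M[R]_(d, r)) (xbar : 'M[R]_(d, r)) (hxbar : is_IAM x xbar)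
    (gamma Phi : R)
    (hcase :
      [/\ region_R delta1 delta2 x xbar,
          gamma = gamma_R (r := r) W t delta1 delta2 &
          Phi = 2 - stack_norm_inf (dev x xbar) ^+ 2]
      \/
      [/\ region_l W t delta3 x xbar,
          gamma = gamma_l W t delta3 x &
          Phi = 2 - stack_norm (dev x xbar) ^+ 2]) :
  [/\ 1 < Phi,
      stack_inner (dev x xbar) (rgrad_phi W t x)
        >= Phi / (2 * Lip W t) * stack_norm (rgrad_phi W t x) ^+ 2 &
      forall nu : R, 0 <= nu <= 1 ->
        stack_inner (dev x xbar) (rgrad_phi W t x)
          >= nu * (Phi / (2 * Lip W t)) * stack_norm (rgrad_phi W t x) ^+ 2
             + (1 - nu) * gamma * stack_norm (dev x xbar) ^+ 2].
Proof.
have m0 := mu_gt0 hW hN ht; have p0 := phi_ge0 hW t x.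
have gap := phi_gap hW x hN ht.
have bS : stiefel xbar by case: hxbar.
have xS : forall i, stiefel (x i) by case: hcase => -[] [].
have r1 : 1 <= r%:R :> R by rewrite ler1n; case/andP: hr.
have D0 : 0 <= stack_norm (dev x xbar) ^+ 2 by exact: sqr_ge0.
set J := stack_inner _ _; set G := stack_norm (rgrad_phi W t x) ^+ 2.
set D := stack_norm (dev x xbar) ^+ 2 in D0 *.
(* These are the only facts specific to a region; the bound with [nu] is a convex combination of the
   first bound and [gammaI]. *)
suff [Phi1 PhiI gammaI] : [/\ 1 < Phi, Phi * phi W t x <= J & gamma * D <= J].
  have PI : Phi / (2 * Lip W t) * G <= J.
    have G0 : 0 <= G by exact: sqr_ge0.
    have GL : G <= 2 * Lip W t * phi W t x by exact (rgrad_phi_le hW t xS).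
    apply: le_trans PhiI; rewrite -mulrA ler_pM2l ?(lt_trans _ Phi1) //.
    (* If Lip <= 0, the left-hand side is nonpositive; division by 0 gives 0. *)
    have [L0|L0] := ltP 0 (2 * Lip W t).
      by rewrite mulrC ler_pdivrMr // mulrC.
    by apply: le_trans p0; rewrite mulr_le0_ge0 // invr_le0.
  split=> // nu /andP[nu0 nu1].
  rewrite -mulrA -[X in _ + X]mulrA.
  have := ler_wpM2l nu0 PI; have : 0 <= 1 - nu by lra.
  by move=> /ler_wpM2l /(_ _ _ gammaI); lra.
(* The natural constant 1 - delta^2 / 4 is weakened to 1 - 4 r delta^2, using r >= 1. *)
have mu_mean_le delta : D <= N%:R * delta ^+ 2 ->
    mu W t * ((1 - 4 * r%:R * delta ^+ 2) * D) <= 2 * phi W t x.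
  move=> Dd; apply: le_trans gap; rewrite ler_pM2l //.
  apply: le_trans (stack_norm_dev_mean_ge hN hxbar xS Dd).
  rewrite ler_wpM2r // lerB //.
  have : delta ^+ 2 <= r%:R * delta ^+ 2 by rewrite ler_peMl // sqr_ge0.
  have := sqr_ge0 delta; lra.
case: hcase => -[[_ h1 h2] gE PE].
- case: hdR => d10 d20 d12 d26.
  have i0 : 0 <= stack_norm_inf (dev x xbar).
    by rewrite /stack_norm_inf; exact: bigmax_ge_id.
  have i2 : stack_norm_inf (dev x xbar) ^+ 2 <= delta2 ^+ 2.
    by rewrite ler_pXn2r // nnegrE // ltW.
  have d2 : delta2 ^+ 2 <= 36^-1.
    have -> : 36^-1 = 6^-1 ^+ 2 :> R by field.
    by rewrite ler_pXn2r // nnegrE ?invr_ge0 // ltW.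
  have PI : Phi * phi W t x <= J.
    rewrite PE; apply: (inner_dev_rgrad_phi hW t xS bS) => i.
    have [fi _] := fnorm_dev_le x xbar i.
    by rewrite ler_pXn2r // nnegrE sqrtr_ge0.
  split=> //; first by rewrite PE; lra.
  rewrite gE /gamma_R; apply: le_trans PI.
  have DM := mu_mean_le _ h1.
  (* Multiplying [DM] by this factor turns 2 phi into (2 - delta2^2) phi, which is at most [Phi]
     times phi. *)
  have c0 : 0 <= 1 - delta2 ^+ 2 / 2 by lra.
  have := ler_wpM2l c0 DM; have : (2 - delta2 ^+ 2) * phi W t x <= Phi * phi W t x.
    by rewrite ler_wpM2r // PE; lra.
  lra.
- case: hdl => d0; rewrite le_min => /andP[_ dr].
  have dr2 : 16 * r%:R * delta3 ^+ 2 <= 1.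
    have r0 : 0 < r%:R :> R by lra.
    have : delta3 ^+ 2 <= (4 * Num.sqrt r%:R)^-1 ^+ 2.
      by rewrite ler_pXn2r // nnegrE ?invr_ge0 ?mulr_ge0 ?sqrtr_ge0 // ltW.
    rewrite exprVn exprMn sqr_sqrtr ?(ltW r0) // (_ : 4 ^+ 2 = 16); last by ring.
    by move=> h; rewrite mulrC -ler_pdivlMr ?mulr_gt0 // div1r.
  have PI : Phi * phi W t x <= J.
    rewrite PE; apply: (inner_dev_rgrad_phi hW t xS bS) => i.
    have [_ fi] := fnorm_dev_le x xbar i.
    by rewrite ler_pXn2r // nnegrE sqrtr_ge0.
  have DM := mu_mean_le _ h2.
  split=> //.
    (* Cancelling [mu] and using 4 r delta3^2 <= 1/4 gives 3/4 D <= 1/2, so D <= 2/3. *)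
    have : mu W t * ((1 - 4 * r%:R * delta3 ^+ 2) * D) <= mu W t * 2^-1 by lra.
    rewrite ler_pM2l // PE -/D => le2.
    have : 3 / 4 * D <= (1 - 4 * r%:R * delta3 ^+ 2) * D by rewrite ler_wpM2r //; lra.
    lra.
  (* The term - phi D occurs in both gamma D and Phi phi, so the claim reduces to [DM]. *)
  rewrite gE /gamma_l; apply: le_trans PI; rewrite PE -/D; lra.
Qed.
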